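(* For $\beta=(\beta_1,\dots,\beta_6)\in\mathbb{C}^6$ let \begin{align*} \mathcal{L}_\beta=\ &(t-1)^4\mathcal{D}_{\log t}^4+2(t-1)^3(t+1)\,\delta\,\mathcal{D}_{\log t}^2+t(t-1)^2\delta^2\\ &+(t-1)^2\bigl(t(t-1)+1-\beta_1-\beta_5t-\beta_6t^2\bigr)\mathcal{D}_{\log t}^2\\ &+t(t-1)\bigl(\beta_4(t-1)-\beta_1-\beta_5-\beta_6\bigr)\delta+t(t-1)(\beta_2t+\beta_3). \end{align*} For constants $\alpha,\gamma$, the gauge transformation $f=t^{\alpha/2}(t-1)^{\gamma/2}g$ converts the equation $0=\mathcal{L}_\beta\,f\cdot f$ as follows: \begin{align*} \mathcal{L}_\beta\,f\cdot f=\ t^{\alpha}(t-1)^{\gamma}\Bigl[&(t-1)^4\mathcal{D}_{\log t}^4+2(t-1)^3(t+1)\,\delta\,\mathcal{D}_{\log t}^2+t(t-1)^2\delta^2\\ &+(t-1)^2\bigl(t(t-1)+1-\beta_1-2\alpha-(\beta_5+4\gamma)t+(-\beta_6+2\alpha+2\gamma)t^2\bigr)\mathcal{D}_{\log t}^2\\ &+t(t-1)\bigl((\beta_4+2\alpha)(t-1)-\beta_1-\beta_5-\beta_6-2\gamma\bigr)\delta\\ &+t(t-1)\bigl((\beta_2+\alpha^2+\alpha\beta_4-\gamma^2+\gamma(\beta_4+\beta_6))t\\ &\qquad+\beta_3-\alpha(\alpha+\beta_1+\beta_4+\beta_5+\beta_6)-\gamma\beta_1-2\alpha\gamma\bigr)\Bigr]g\cdot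 g. \end{align*} That is, the right-hand side is $t^{\alpha}(t-1)^{\gamma}\mathcal{L}_{\beta'}\,g\cdot g$ with \begin{align*} &\beta_1'=\beta_1+2\alpha,\quad \beta_4'=\beta_4+2\alpha,\quad \beta_5'=\beta_5+4\gamma,\quad \beta_6'=\beta_6-2\alpha-2\gamma,\\ &\beta_2'=\beta_2+\alpha^2+\alpha\beta_4-\gamma^2+\gamma(\beta_4+\beta_6),\\ &\beta_3'=\beta_3-\alpha(\alpha+\beta_1+\beta_4+\beta_5+\beta_6)-\gamma\beta_1-2\alpha\gamma. \end{align*} With this transformation the equation $0=\mathcal{L}_\beta\,f\cdot f$ can be reduced to the case $\beta_5=\beta_6=0$. The quantity $2\beta_4+\beta_5+2\beta_6$ is invariant under the gauge transformation.
   Context: $\delta=t\frac{d}{dt}$, and the Hirota derivative for $\delta$ is $\mathcal{D}_{\log t}^N f\cdot g=\sum_{i=0}^N(-1)^i\binom{N}{i}(\delta^{N-i}f)(\delta^i g)$. Expressions such as $\delta^j\mathcal{D}_{\log t}^k\, f\cdot f$ mean $\delta^j\bigl(\mathcal{D}_{\log t}^k f\cdot f\bigr)$; with $k=0$, $\delta^j f\cdot f=\delta^j(f^2)$, and a function $c(t)$ acts by $c(t)\,f\cdot f=c(t)f^2$. The equation $\mathcal{L}_\beta f\cdot f=0$ is a fourth-order homogeneous quadratic differential equation for $f$ with fixed singular points $t=0,1,\infty$. *)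

(* Defs.v *)
From HB Require Import structures.
From mathcomp Require Import all_boot all_order all_algebra.
From mathcomp Require Import complex.
From mathcomp Require Import all_classical all_reals all_analysis.

Set Implicit Arguments.
Unset Strict Implicit.
Unset Printing Implicit Defensive.

Import Order.TTheory GRing.Theory Num.Theory.
Import numFieldNormedType.Exports.

Local Open Scope ring_scope.
Local Open Scope complex_scope.
Local Open Scope classical_set_scope.

(* The field of complex numbers. The constant of type numFieldType makes
   inference find the normed module structure of C over itself, so that derive1
   and derivable below are complex differentiation. *)
Definition Cplx (R : realType) : numFieldType := R[i].

Section Operators.
Context {R : realType}.
Local Notation C := (Cplx R).
Implicit Types (f g : C -> C) (U : set C).

Definition delta f : C -> C := fun t => t * derive1 f t.

Definition hirota (N : nat) f g : C -> C := fun t =>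
  \sum_(i < N.+1)
     (-1) ^+ i * 'C(N, i)%:R * iter (N - i) delta f t * iter i delta g t.

Record params := Params {
  beta1 : C; beta2 : C; beta3 : C; beta4 : C; beta5 : C; beta6 : C }.

(* The quadratic differential expression written L_beta f.f. *)
Definition Lop (b : params) f : C -> C := fun t =>
    (t - 1) ^+ 4 * hirota 4 f f t
  + 2 * (t - 1) ^+ 3 * (t + 1) * delta (hirota 2 f f) t
  + t * (t - 1) ^+ 2 * delta (delta (fun s => f s ^+ 2)) t
  + (t - 1) ^+ 2
      * (t * (t - 1) + 1 - beta1 b - beta5 b * t - beta6 b * t ^+ 2)
      * hirota 2 f f t
  + t * (t - 1) * (beta4 b * (t - 1) - beta1 b - beta5 b - beta6 b)
      * delta (fun s => f s ^+ 2) t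
  + t * (t - 1) * (beta2 b * t + beta3 b) * f t ^+ 2.

(* beta', for the gauge exponents alpha = a and gamma = c. *)
Definition gauge_params (a c : C) (b : params) : params := {|
  beta1 := beta1 b + 2 * a;
  beta2 := beta2 b + a ^+ 2 + a * beta4 b - c ^+ 2 + c * (beta4 b + beta6 b);
  beta3 := beta3 b - a * (a + beta1 b + beta4 b + beta5 b + beta6 b)
             - c * beta1 b - 2 * a * c;
  beta4 := beta4 b + 2 * a;
  beta5 := beta5 b + 4 * c;
  beta6 := beta6 b - 2 * a - 2 * c |}.

Definition cexp (z : C) : C :=
  (expR (complex.Re z) * cos (complex.Im z))
    +i* (expR (complex.Re z) * sin (complex.Im z)).

(* [l] is a branch of log h on U; in particular h has no zero on U. *)
Definition log_branch U (h l : C -> C) : Prop :=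
  forall t, U t -> {for t, continuous l} /\ cexp (l t) = h t.

(* An open set U on which branches l0 of log t and l1 of log (t - 1) are fixed.
   Such a U contains neither 0 nor 1, and every other point of the plane has a
   neighbourhood of this kind. *)
Definition branched_domain U (l0 l1 : C -> C) : Prop :=
  [/\ open U, log_branch U (fun t => t) l0
            & log_branch U (fun t => t - 1) l1].

(* t^a (t - 1)^c, for the branches l0 and l1 of the two logarithms. *)
Definition gauge_factor (l0 l1 : C -> C) (a c : C) : C -> C :=
  fun t => cexp (a * l0 t) * cexp (c * l1 t).

(* f = t^(a/2) (t - 1)^(c/2) g on U. *)
Definition gauge_related U (l0 l1 : C -> C) (a c : C) f g : Prop :=
  forall t, U t -> f t = gauge_factor l0 l1 (a / 2) (c / 2) t * g t.

(* Four times complex differentiable on U; for open U this is the same as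
   holomorphic on U. *)
Definition differentiable4 U f : Prop :=
  forall k t, (k < 4)%N -> U t -> derivable (derive1n k f) t 1.

Definition solution (b : params) U f : Prop :=
  differentiable4 U f /\ forall t, U t -> Lop b f t = 0.

End Operators.

Arguments params : clear implicits.

(* Main.v *)
Require Import Defs.
From HB Require Import structures.
From mathcomp Require Import all_boot all_order all_algebra complex.
From mathcomp Require Import all_classical all_reals all_analysis.
From mathcomp Require Import ring.

Import Order.TTheory GRing.Theory Num.Theory.
Import numFieldNormedType.Exports.
Local Open Scope ring_scope.
Local Open Scope classical_set_scope.

(** With [h = t^(a/2) (t-1)^(c/2)] one has [delta h = h u] for the rational
    function [u = a/2 + (c/2) t/(t-1)]. Hence for [f = h g] every [delta^k f],
    [k <= 4], is [h] times a polynomial in the iterated [delta]-derivatives of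
    [g] and of [u], and [L_beta f.f], which is quadratic in these, is [h^2]
    times an expression to which a rational-function identity applies. The
    analytic input is that the branches of the logarithm and the complex
    exponential are complex differentiable; [cexp] is defined from the real
    [expR], [cos], [sin], and a merely continuous branch [l] of [log (t - k)]
    is differentiable because the difference quotient of [cexp] extends
    continuously to the diagonal with nonzero values. *)

(** Carathéodory's criterion: off [x] the difference quotient equals [g], so continuity of [g] at
    [x] gives its limit. *)
Lemma is_derive_slope {K : numFieldType} (f g : K -> K) (x : K) :
  (\forall z \near x, f z - f x = g z * (z - x)) -> {for x, continuous g} ->
  is_derive x 1 f (g x).
Proof.
move=> fg gx.
have cv : h^-1 *: (f (h *: (1 : K) + x) - f x) @[h --> 0^'] --> g x.
  have gcv : g (h + x) @[h --> 0^'] --> g x.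
    exact: (continuous_withinNshiftx g x).2 gx.
  apply: cvg_trans gcv; apply: near_eq_cvg.
  have H : \forall h \near (0 : K), f (h + x) - f x = g (h + x) * (h + x - x).
    by move: fg; rewrite (near_shift 0 x); apply: filterS => h; rewrite /= subr0.
  apply: filterS H => h fh h0.
  by rewrite -[h *: 1]/(h * 1) mulr1 fh addrK -[_ *: _]/(_ * _) mulrC mulfK.
apply: DeriveDef; first by apply/cvg_ex; exists (g x).
exact: cvg_lim cv.
Qed.

(** * The complex exponential: functional equation and slope at 0 *)

Section ComplexExponential.
Context {R : realType}.
Local Notation C := (Cplx R).
Local Notation Re := complex.Re.
Local Notation Im := complex.Im.

Lemma normc_ge_Im (w : R[i]) : `|Im w|%:C%C <= `|w|.
Proof. by rewrite normc_def lecR -sqrtr_sqr ler_sqrt ?addr_ge0 ?sqr_ge0 // lerDr sqr_ge0. Qed.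

Lemma normc_le_ReIm (w : R[i]) : `|w| <= (`|Re w| + `|Im w|)%:C%C.
Proof.
rewrite normc_def lecR -[leRHS]ger0_norm ?addr_ge0 // -sqrtr_sqr ler_sqrt ?sqr_ge0 //.
rewrite sqrrD !real_normK ?num_real // lerD2r lerDl mulrn_wge0 // mulr_ge0.
Qed.

Lemma Re_cvg0 : (Re (w : C) : R) @[w --> (0 : C)] --> (0 : R).
Proof.
have FF : Filter (nbhs (0 : C)) by typeclasses eauto.
apply: (cvgrPdist_lt (F := nbhs (0 : C)) _ _).2 => e e0.
have e0' : 0 < (e%:C%C : C) by rewrite ltcR.
apply: (filterS (F := nbhs (0 : C)) _ (@nbhs0_lt C C _ e0')) => w we.
by rewrite sub0r normrN -ltcR (le_lt_trans (normc_ge_Re w)).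
Qed.

Lemma Im_cvg0 : (Im (w : C) : R) @[w --> (0 : C)] --> (0 : R).
Proof.
have FF : Filter (nbhs (0 : C)) by typeclasses eauto.
apply: (cvgrPdist_lt (F := nbhs (0 : C)) _ _).2 => e e0.
have e0' : 0 < (e%:C%C : C) by rewrite ltcR.
apply: (filterS (F := nbhs (0 : C)) _ (@nbhs0_lt C C _ e0')) => w we.
by rewrite sub0r normrN -ltcR (le_lt_trans (normc_ge_Im w)).
Qed.

Lemma cexpD (z w : C) : cexp (z + w) = cexp z * cexp w.
Proof.
case: z => a b; case: w => c d; rewrite /cexp /=.
rewrite expRD cosD sinD.
apply/eqP; rewrite eq_complex /=; apply/andP; split; apply/eqP; ring.
Qed.

Lemma cexp0 : cexp 0 = 1 :> C.
Proof. by rewrite /cexp /= expR0 cos0 sin0 mulr1 mulr0. Qed.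

Lemma cexp_neq0 (z : C) : cexp z != 0.
Proof.
apply/eqP => z0; have := cexpD z (- z).
by rewrite subrr cexp0 z0 mul0r => /eqP; rewrite oner_eq0.
Qed.

(** The slope [E] of [cexp] at 0 is controlled by the real slopes [p], [s], [q] of [expR], [sin],
    [cos] at 0, whose values there are 1, 1 and 0. They bound [cexp w - 1 - w] by [N w] times the
    norm of [w], with [N] tending to 0. *)
Lemma cexp_slope : exists E : C -> C,
  [/\ forall w, cexp w - 1 = E w * w, E 0 = 1 & {for 0, continuous E}].
Proof.
have [p [pE pc p0]] := (is_derive1_caratheodory _ _ _).1 (is_derive_expR (0 : R)).
have [s [sE sc s0]] := (is_derive1_caratheodory _ _ _).1 (is_derive_sin (0 : R)).
have [q [qE qc q0]] := (is_derive1_caratheodory _ _ _).1 (is_derive_cos (0 : R)).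
rewrite expR0 in pE p0; rewrite sin0 cos0 in sE s0; rewrite cos0 sin0 in qE q0.
(* The quotient alone would be 0 at [w = 0], since division by zero gives 0; the value 1 makes [E]
   continuous. *)
pose E (w : C) : C := if w == 0 then 1 else (cexp w - 1) / w.
have E0 : E 0 = 1 by rewrite /E eqxx.
exists E; split; [move=> w|exact: E0|].
  rewrite /E; case: eqP => [->|/eqP w0]; last by rewrite divfK.
  by rewrite cexp0 subrr mulr0.
(* The four terms are the coefficients of [Im w] and [Re w] in the real and imaginary parts of
   [cexp w - 1 - w], as split in [key]. *)
pose N (w : C) : R := expR (Re w) * `|q (Im w)| + `|p (Re w) - 1|
  + expR (Re w) * `|s (Im w) - 1| + `|expR (Re w) - 1|.
have Nc : N w @[w --> (0 : C)] --> (0 : R).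
  have FF : Filter (nbhs (0 : C)) by typeclasses eauto.
  (* The limit is written in the shape of [N], so that the limit rules apply term by term. *)
  have -> : 0 = expR 0 * `|0 : R| + `|1 - 1 : R| + expR 0 * `|1 - 1 : R|
      + `|expR 0 - 1| :> R.
    by rewrite expR0 subrr normr0 !mulr0 !addr0.
  have ec : expR (Re w) @[w --> (0 : C)] --> expR (0 : R).
    by apply: (cvg_comp (fun w : C => Re w) expR Re_cvg0); exact: continuous_expR.
  apply: cvgD; last by apply: cvg_norm; apply: cvgB => //; exact: cvg_cst.
  apply: cvgD; first (apply: cvgD; first apply: cvgM => //).
  - apply: cvg_norm; rewrite -[X in _ --> X]oppr0 -q0.
    by apply: (cvg_comp (fun w : C => Im w) q Im_cvg0); exact: qc.
  - apply: cvg_norm; apply: cvgB; last exact: cvg_cst.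
    by rewrite -[X in _ --> X]p0; apply: (cvg_comp (fun w : C => Re w) p Re_cvg0); exact: pc.
  - apply: cvgM => //; apply: cvg_norm; apply: cvgB; last exact: cvg_cst.
    by rewrite -[X in _ --> X]s0; apply: (cvg_comp (fun w : C => Im w) s Im_cvg0); exact: sc.
have key w : `|cexp w - 1 - w| <= (N w)%:C%C * `|w|.
  have xw := normc_ge_Re w; have yw := normc_ge_Im w.
  apply: le_trans (normc_le_ReIm _) _.
  (* The norm on [C] takes values in [C]; naming its real value moves the inequality to [R]. *)
  have [n nE] : exists n : R, `|w| = n%:C%C by rewrite normc_def; eexists.
  rewrite nE in xw yw *; rewrite -[leRHS]rmorphM /= lecR.
  rewrite !lecR in xw yw.
  case: w xw yw {nE} => x y /= xw yw.
  have -> : expR x * cos y - 1 - x = expR x * q y * y + (p x - 1) * x.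
    have := qE y; have := pE x; rewrite !subr0 => px qy.
    rewrite -[expR x * q y * y]mulrA -qy mulrBl -px; ring.
  have -> : expR x * sin y - 0 - y = expR x * (s y - 1) * y + (expR x - 1) * y.
    have := sE y; rewrite !subr0 => ->; ring.
  rewrite /N /=.
  apply: (@le_trans _ _ (expR x * `|q y| * `|y| + `|p x - 1| * `|x| +
      (expR x * `|s y - 1| * `|y| + `|expR x - 1| * `|y|))).
    apply: lerD; apply: (le_trans (ler_normD _ _));
      by rewrite !normrM (ger0_norm (expR_ge0 x)).
  rewrite !mulrDl -!addrA.
  by repeat apply: lerD; apply: ler_wpM2l => //; rewrite ?mulr_ge0 ?expR_ge0.
suff H : E w @[w --> (0 : C)] --> (1 : C) by rewrite -E0 in H.
have FF : Filter (nbhs (0 : C)) by typeclasses eauto.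
apply: (cvgrPdist_le (F := nbhs (0 : C)) _ _).2 => e e0.
(* The tolerance is a positive element of [C], hence real. *)
have eR : e = (Re e)%:C%C.
  by apply/esym/RRe_real/gtr0_real.
have e0' : 0 < Re e by rewrite -ltcR -eR.
have := @cvgr_dist_le _ _ _ (nbhs (0 : C)) FF _ _ Nc _ e0'.
apply: (filterS (F := nbhs (0 : C))) => w; rewrite sub0r normrN => Nw.
rewrite /E; case: eqP => [_|/eqP w0]; first by rewrite subrr normr0 ltW.
have -> : 1 - (cexp w - 1) / w = - ((cexp w - 1 - w) / w) by field.
rewrite normrN normrM normfV ler_pdivrMr ?normr_gt0 //.
apply: le_trans (key w) _; rewrite ler_wpM2r // eR lecR.
exact: le_trans (ler_norm _) Nw.
Qed.
End ComplexExponential.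

(** * Chain rule and repeated differentiability on an open set *)

Section Derivatives.
Context {K : numFieldType}.
Implicit Types (f g h v : K -> K) (U : set K) (t : K).

(** The chain rule for differentials; by linearity, the differential of [f] at [a = a * 1] is [a]
    times its value at 1. *)
Lemma is_derive_comp_num f g t a b :
  is_derive (g t) 1 f a -> is_derive t 1 g b -> is_derive t 1 (f \o g) (a * b).
Proof.
move=> [fd <-] [gd <-].
have fd' := fd; have gd' := gd.
move/derivable1_diffP in fd'; move/derivable1_diffP in gd'.
have fgd : differentiable (f \o g) t by exact: differentiable_comp.
apply: DeriveDef; first exact/derivable1_diffP.
rewrite -derive1E derive1E' // diff_comp // -!derive1E !derive1E' //=.
by rewrite -[X in 'd _ _ X = _]mulr1 [LHS]linearZ mulrC.
Qed.

(* [derivs 4] at [K := Cplx R] unfolds to [differentiable4]. *)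
Definition derivs n U f : Prop :=
  forall k t, (k < n)%N -> U t -> derivable (derive1n k f) t 1.

Lemma derivs0 U f : derivs 0 U f. Proof. by move=> k t; rewrite ltn0. Qed.

(** Peels off the innermost derivative; the closure properties below are inductions along this
    recursion. *)
Lemma derivsS n U f : derivs n.+1 U f <->
  (forall t, U t -> derivable f t 1) /\ derivs n U (derive1 f).
Proof.
split=> [df|[d0 df] [|k] t].
  split=> [t|k t kn]; first exact: df 0 t _.
  by rewrite -derive1Sn; exact: df.
- by move=> _; exact: d0.
- by rewrite ltnS derive1Sn; exact: df.
Qed.

Lemma derivs_derivable n U f t : derivs n.+1 U f -> U t -> derivable f t 1.
Proof. by move=> /derivsS[df _]; exact: df. Qed.

Lemma derivsW n m U f : (m <= n)%N -> derivs n U f -> derivs m U f.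
Proof. by move=> mn df k t km; apply: df; exact: leq_trans km mn. Qed.

Section OpenDomain.
Context (U : set K) (oU : open U).

Lemma near_eq_open f g t : U t -> (forall s, U s -> f s = g s) ->
  \forall s \near t, f s = g s.
Proof. by move=> Ut fg; move: (open_nbhs_nbhs (conj oU Ut)); exact: filterS. Qed.

(** Since [U] is open, equality on [U] holds near each of its points and passes to the
    derivatives. *)
Lemma eq_derivs n f g : (forall t, U t -> f t = g t) ->
  derivs n U f -> derivs n U g.
Proof.
elim: n f g => [|n IH] f g; first by move=> *; exact: derivs0.
move=> fg /derivsS[d0 df]; apply/derivsS; split=> [t Ut|].
  exact: near_eq_derivable (near_eq_open _ _ _ Ut fg) (d0 t Ut).
apply: IH df => t Ut; rewrite !derive1E.
exact: near_eq_derive (near_eq_open _ _ _ Ut fg).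
Qed.

Lemma derivs_cst n k : derivs n U (fun=> k).
Proof.
elim: n k => [k|n IH k]; first exact: derivs0.
apply/derivsS; split=> [t _|]; first exact: derivable_cst.
by apply: (eq_derivs _ (fun=> 0)) (IH 0) => t _; rewrite derive1_cst.
Qed.

Lemma derivs_id n : derivs n U id.
Proof.
case: n => [|n]; first exact: derivs0.
apply/derivsS; split=> [t _|]; first exact: derivable_id.
by apply: (eq_derivs _ (fun=> 1)) (derivs_cst n 1) => t _; rewrite derive1E derive_id.
Qed.

Lemma derivsD n f g :
  derivs n U f -> derivs n U g -> derivs n U (fun t => f t + g t).
Proof.
elim: n f g => [|n IH] f g; first by move=> *; exact: derivs0.
move=> /derivsS[f0 df] /derivsS[g0 dg].
apply/derivsS; split=> [t Ut|]; first by apply: derivableD; [exact: f0|exact: g0].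
apply: (eq_derivs _ (fun t => derive1 f t + derive1 g t)) => [t Ut|]; last exact: IH.
by rewrite !derive1E deriveD //; [exact: f0|exact: g0].
Qed.

Lemma derivsM n f g :
  derivs n U f -> derivs n U g -> derivs n U (fun t => f t * g t).
Proof.
elim: n f g => [|n IH] f g; first by move=> *; exact: derivs0.
move=> df dg.
have [f0 df'] := (derivsS _ _ _).1 df; have [g0 dg'] := (derivsS _ _ _).1 dg.
apply/derivsS; split=> [t Ut|]; first by apply: derivableM; [exact: f0|exact: g0].
have dfn : derivs n U f by exact: derivsW df.
have dgn : derivs n U g by exact: derivsW dg.
apply: (eq_derivs _ (fun t => f t * derive1 g t + g t * derive1 f t)) => [t Ut|].
  by rewrite !derive1E deriveM //; [exact: f0|exact: g0].
by apply: derivsD; exact: IH.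
Qed.

(** The derivative of [1/f] is [- f' / f^2], which involves only [1/f] and [f']; the induction thus
    runs with [f] fixed. *)
Lemma derivsV n f : (forall t, U t -> f t != 0) ->
  derivs n U f -> derivs n U (fun t => (f t)^-1).
Proof.
move=> fn0; elim: n => [|n IH] df; first exact: derivs0.
have [f0 df'] := (derivsS _ _ _).1 df.
apply/derivsS; split=> [t Ut|]; first by apply: derivableV; [exact: fn0|exact: f0].
have dV : derivs n U (fun t => (f t)^-1) by apply: IH; exact: derivsW df.
apply: (eq_derivs _ (fun t => -1 * ((f t)^-1 * (f t)^-1 * derive1 f t))) => [t Ut|].
  rewrite !derive1E deriveV ?fn0 //; last exact: f0.
  by rewrite -[_ *: _]/(_ * _) expr2 invfM; ring.
apply: (derivsM _ (fun=> -1)); first exact: derivs_cst.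
exact: (derivsM _ (fun t => (f t)^-1 * (f t)^-1) (derive1 f)
  (derivsM _ _ _ dV dV) df').
Qed.

(** Bootstrapping: in [h' = v h] the right-hand side is as regular as [h], so [h] gains one order at
    each step while [v] permits. *)
Lemma derivs_linear_ode n h v : derivs n U v ->
  (forall t, U t -> is_derive t 1 h (v t * h t)) -> derivs n U h.
Proof.
move=> dv hv; elim: n dv => [|n IH] dv; first exact: derivs0.
apply/derivsS; split=> [t Ut|].
  by have [] := hv t Ut.
have dvn : derivs n U v by exact: derivsW dv.
apply: (eq_derivs _ (fun t => v t * h t)) => [t Ut|]; last exact: derivsM (IH dvn).
by have [_] := hv t Ut; rewrite derive1E.
Qed.

End OpenDomain.
End Derivatives.

(** * Derivatives of an abstract exponential and of its continuous logarithms *)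

Section ExponentialSlope.
Context {K : numFieldType} (e E : K -> K).
Context (eD : forall z w, e (z + w) = e z * e w).
Context (eE : forall w, e w - 1 = E w * w).
Context (E0 : E 0 = 1).
Context (Ec : {for 0, continuous E}).

(** By the functional equation [e w - e z = e z * (e (w - z) - 1)], so the slope at [z] is
    [e z * E (w - z)]. *)
Lemma is_derive_exponential (z : K) : is_derive z 1 e (e z).
Proof.
pose G (w : K) := e z * E (w - z).
have Gz : G z = e z by rewrite /G subrr E0 mulr1.
rewrite -[X in is_derive _ _ _ X]Gz; apply: is_derive_slope.
  apply: (filterS (F := nbhs z) _ filterT) => w _; rewrite /G -mulrA -eE mulrBr mulr1 -eD.
  by rewrite [z + _]addrC subrK.
apply: continuousM; first exact: cst_continuous.
apply: (@continuous_comp _ _ _ (fun w => w - z) E); last by rewrite subrr.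
by apply: continuousB; [exact: cvg_id|exact: cst_continuous].
Qed.

(* [s - t = e (l t) * E (l s - l t) * (l s - l t)] yields the slope of [l] at [t]. *)
Lemma is_derive_logarithm (U : set K) (l : K -> K) (k t : K) : open U ->
  (forall s, U s -> {for s, continuous l} /\ e (l s) = s - k) -> U t ->
  t - k != 0 -> is_derive t 1 l (t - k)^-1.
Proof.
move=> oU lU Ut tk; have [lc lt] := lU t Ut.
pose G (s : K) := ((t - k) * E (l s - l t))^-1.
have Gt : G t = (t - k)^-1 by rewrite /G subrr E0 mulr1.
rewrite -Gt; apply: is_derive_slope.
  have : nbhs t U by exact: (open_nbhs_nbhs (conj oU Ut)).
  apply: filterS => s Us; have [_ ls] := lU s Us.
  have st : s - t = (t - k) * E (l s - l t) * (l s - l t).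
    have -> : s - t = (s - k) - (t - k) by ring.
    rewrite -mulrA -eE -ls -lt mulrBr mulr1 -eD.
    by rewrite [l t + _]addrC subrK.
  (* If [E] vanished here, then [s = t], where its value is [E 0 = 1]. *)
  have Es : E (l s - l t) != 0.
    apply/eqP => Es; move: st; rewrite Es mulr0 mul0r => /eqP.
    rewrite subr_eq0 => /eqP st; move: Es; rewrite st subrr E0 => /eqP.
    by rewrite oner_eq0.
  by rewrite /G {1}st mulKf // mulf_neq0.
apply: continuousV; first by rewrite subrr E0 mulr1.
apply: continuousM; first exact: cst_continuous.
apply: (@continuous_comp _ _ _ (fun s => l s - l t) E); last by rewrite subrr.
by apply: continuousB => //; exact: cst_continuous.
Qed.
End ExponentialSlope.

(** * Hirota sums and the Euler derivation *)

Lemma hirota2_sum (K : comNzRingType) (F : nat -> K) :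
  \sum_(i < 3) (-1) ^+ i * 'C(2, i)%:R * F (2 - i)%N * F i =
  2 * F 0%N * F 2%N - 2 * (F 1%N * F 1%N).
Proof. rewrite !big_ord_recr big_ord0 /= bin0 bin1 binn !subSS !subn0; ring. Qed.

(** [F i] stands for the value of [delta^i f] at a point. The order is even, so the terms [i] and
    [4 - i] coincide. *)
Lemma hirota4_sum (K : comNzRingType) (F : nat -> K) :
  \sum_(i < 5) (-1) ^+ i * 'C(4, i)%:R * F (4 - i)%N * F i =
  2 * F 0%N * F 4%N - 8 * F 1%N * F 3%N + 6 * F 2%N ^+ 2.
Proof. rewrite !big_ord_recr big_ord0 /= bin0 bin1 binn !subSS !subn0
  (_ : 'C(4, 2) = 6)%N // (_ : 'C(4, 3) = 4)%N //; ring. Qed.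

Section EulerDerivation.
Context {K : numFieldType}.
Implicit Types (f g : K -> K) (U : set K) (t : K).

(* [delta] over a general field; at [K := Cplx R] the second component is [delta f t = d]. *)
Definition is_delta f t d := derivable f t 1 /\ t * derive1 f t = d.

Lemma is_delta_cst t k : is_delta (fun=> k) t 0.
Proof. by split; [exact: derivable_cst|rewrite derive1_cst mulr0]. Qed.

Lemma is_delta_id t : is_delta id t t.
Proof. by split; [exact: derivable_id|rewrite derive1E derive_id mulr1]. Qed.

Lemma is_deltaD f g t d e : is_delta f t d -> is_delta g t e ->
  is_delta (fun s => f s + g s) t (d + e).
Proof.
move=> [df <-] [dg <-]; split; first exact: derivableD.
by rewrite !derive1E deriveD // mulrDr.
Qed.

Lemma is_deltaM f g t d e : is_delta f t d -> is_delta g t e ->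
  is_delta (fun s => f s * g s) t (d * g t + f t * e).
Proof.
move=> [df <-] [dg <-]; split; first exact: derivableM.
rewrite !derive1E deriveM //.
rewrite -[f t *: _]/(f t * _) -[g t *: _]/(g t * _); ring.
Qed.

Lemma is_deltaV f t d : f t != 0 -> is_delta f t d ->
  is_delta (fun s => (f s)^-1) t (- d / f t ^+ 2).
Proof.
move=> f0 [df <-]; split; first exact: derivableV.
rewrite !derive1E deriveV // -[_ *: _]/(_ * _); ring.
Qed.

Lemma near_is_delta f g t d : (\forall s \near t, f s = g s) ->
  is_delta g t d -> is_delta f t d.
Proof.
move=> fg [dg <-]; split; last by rewrite !derive1E (near_eq_derive _ fg).
by apply: near_eq_derivable dg; apply: filterS fg => s ->.
Qed.

Lemma is_delta_eq f t d e : is_delta f t d -> d = e -> is_delta f t e.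
Proof. by move=> ? <-. Qed.

Lemma is_deltaN f t d : is_delta f t d -> is_delta (fun s => - f s) t (- d).
Proof.
move=> [df <-]; split; first exact: derivableN.
by rewrite !derive1E deriveN // mulrN.
Qed.

Lemma is_deltaX f t d n : is_delta f t d ->
  is_delta (fun s => f s ^+ n.+1) t (n.+1%:R * f t ^+ n * d).
Proof.
move=> fd; elim: n => [|n IH].
  by apply: (is_delta_eq _ _ d) => //; rewrite mulr1 mul1r.
have -> : (fun s => f s ^+ n.+2) = (fun s => f s * f s ^+ n.+1).
  by apply/funext => s; rewrite exprS.
apply: is_delta_eq (is_deltaM _ _ _ _ _ fd IH) _.
rewrite [n.+2%:R]mulrS exprS; ring.
Qed.

(** Differentiates along the syntax and fills in the unknown value, which [ring] or [field] then
    compares with the expected one. In the first case [?k] cannot depend on [s]; atoms are looked up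
    among the hypotheses. *)
Ltac delta_solve := match goal with
  | |- is_delta (fun s => ?k) _ _ => refine (is_delta_cst _ k)
  | |- is_delta (fun s => s) _ _ => refine (is_delta_id _)
  | |- is_delta (fun s => @Algebra.add _ (@?f s) (@?g s)) _ _ =>
      refine (is_deltaD _ _ _ _ _ _ _); delta_solve
  | |- is_delta (fun s => @Algebra.opp _ (@?f s)) _ _ =>
      refine (is_deltaN _ _ _ _); delta_solve
  | |- is_delta (fun s => @GRing.mul _ (@?f s) (@?g s)) _ _ =>
      refine (is_deltaM _ _ _ _ _ _ _); delta_solve
  | |- is_delta (fun s => @GRing.exp _ (@?f s) (S ?n)) _ _ =>
      refine (is_deltaX _ _ _ n _); delta_solve
  | H : is_delta ?f _ _ |- is_delta ?f _ _ => refine H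
  end.

(** Models [f, delta f, ..., delta^4 f] on [U] over any field [K], whereas [delta] itself is defined
    over [C] only. *)
Definition delta_tower U (F : nat -> K -> K) :=
  forall k t, (k < 4)%N -> U t -> is_delta (F k) t (F k.+1 t).

Section Tower.
Context (U : set K) (oU : open U) (F : nat -> K -> K) (FU : delta_tower U F).
Context (t : K) (Ut : U t).

Let F0 : is_delta (F 0%N) t (F 1%N t). Proof. exact: FU. Qed.
Let F1 : is_delta (F 1%N) t (F 2%N t). Proof. exact: FU. Qed.
Let F2 : is_delta (F 2%N) t (F 3%N t). Proof. exact: FU. Qed.

Lemma is_delta_hirota2 :
  is_delta (fun s => 2 * F 0%N s * F 2%N s - 2 * (F 1%N s * F 1%N s)) t
    (2 * F 0%N t * F 3%N t - 2 * F 1%N t * F 2%N t).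
Proof. eapply is_delta_eq; [by delta_solve|rewrite /=; ring]. Qed.

Lemma is_delta_sqr :
  is_delta (fun s => F 0%N s ^+ 2) t (2 * F 0%N t * F 1%N t).
Proof. eapply is_delta_eq; [by delta_solve|rewrite /=; ring]. Qed.

(** [d] plays the role of [delta (f^2)], whose formula is known on [U] only; openness of [U] allows
    differentiating it there. *)
Lemma is_delta2_sqr (d : K -> K) : (forall s, U s -> d s = 2 * F 0%N s * F 1%N s) ->
  is_delta d t (2 * F 1%N t ^+ 2 + 2 * F 0%N t * F 2%N t).
Proof.
move=> dE; apply: near_is_delta (near_eq_open _ oU _ _ _ Ut dE) _.
eapply is_delta_eq; [by delta_solve|rewrite /=; ring].
Qed.
End Tower.

Lemma is_delta_unique f t d e : is_delta f t d -> is_delta f t e -> d = e.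
Proof. by move=> [_ <-] [_ <-]. Qed.

(** * Effect of a gauge factor on iterated derivatives *)

Section GaugeTower.
Context (U : set K) (oU : open U) (F G : nat -> K -> K).
Context (FU : delta_tower U F) (GU : delta_tower U G).
Context (h u u1 u2 u3 : K -> K).
Context (hu : forall t, U t -> is_delta h t (h t * u t)).
Context (uU : forall t, U t ->
  [/\ is_delta u t (u1 t), is_delta u1 t (u2 t) & is_delta u2 t (u3 t)]).
Context (FG : forall t, U t -> F 0%N t = h t * G 0%N t).

(** The product rule with [delta h = h u]: conjugation by [h] turns [delta] into [delta + u]. *)
Let step k (P Q : K -> K) : (k < 4)%N ->
  (forall t, U t -> F k t = h t * P t) ->
  (forall t, U t -> is_delta P t (Q t)) ->
  forall t, U t -> F k.+1 t = h t * (u t * P t + Q t).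
Proof.
move=> k4 FP PQ t Ut; apply: is_delta_unique (FU k t k4 Ut) _.
apply: near_is_delta (near_eq_open _ oU _ _ _ Ut FP) _.
apply: is_delta_eq (is_deltaM _ _ _ _ _ (hu t Ut) (PQ t Ut)) _; ring.
Qed.

(** These are the expansions of [(delta + u)^k] for [k] up to 4: the coefficient of [G j] in [F k]
    is ['C(k, j)] times the complete Bell polynomial of degree [k - j] in [u, u1, u2, u3]. *)
Lemma gauge_tower t : U t -> [/\
  F 1%N t = h t * (u t * G 0%N t + G 1%N t),
  F 2%N t = h t * ((u1 t + u t ^+ 2) * G 0%N t + 2 * u t * G 1%N t + G 2%N t),
  F 3%N t = h t * ((u2 t + 3 * u t * u1 t + u t ^+ 3) * G 0%N t
    + 3 * (u1 t + u t ^+ 2) * G 1%N t + 3 * u t * G 2%N t + G 3%N t) &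
  F 4%N t = h t * ((u3 t + 4 * u t * u2 t + 3 * u1 t ^+ 2
      + 6 * u t ^+ 2 * u1 t + u t ^+ 4) * G 0%N t
    + 4 * (u2 t + 3 * u t * u1 t + u t ^+ 3) * G 1%N t
    + 6 * (u1 t + u t ^+ 2) * G 2%N t + 4 * u t * G 3%N t + G 4%N t)].
Proof.
have GU' k s : (k < 4)%N -> U s -> is_delta (G k) s (G k.+1 s) by exact: GU.
pose P1 s := u s * G 0%N s + G 1%N s.
pose P2 s := (u1 s + u s ^+ 2) * G 0%N s + 2 * u s * G 1%N s + G 2%N s.
pose P3 s := (u2 s + 3 * u s * u1 s + u s ^+ 3) * G 0%N s
    + 3 * (u1 s + u s ^+ 2) * G 1%N s + 3 * u s * G 2%N s + G 3%N s.
have H1 s : U s -> F 1%N s = h s * P1 s.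
  by move=> Us; rewrite (step 0 (G 0%N) (G 1%N)) // => r Ur; exact: GU.
have H2 s : U s -> F 2%N s = h s * P2 s.
  (* The explicit function is [delta P1]; likewise for [P2] and [P3] below. *)
  move=> Us; rewrite (step 1 P1 (fun r => u1 r * G 0%N r + u r * G 1%N r + G 2%N r)) //.
    by rewrite /P1 /P2; ring.
  move=> r Ur; have [D0 _ _] := uU r Ur.
  have E0 := GU 0%N r isT Ur; have E1 := GU 1%N r isT Ur.
  by rewrite /P1; eapply is_delta_eq; [by delta_solve|rewrite /=; ring].
have H3 s : U s -> F 3%N s = h s * P3 s.
  move=> Us; rewrite (step 2 P2 (fun r => (u2 r + 2 * u r * u1 r) * G 0%N r
     + (3 * u1 r + u r ^+ 2) * G 1%N r + 2 * u r * G 2%N r + G 3%N r)) //.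
    by rewrite /P2 /P3; ring.
  move=> r Ur; have [D0 D1 _] := uU r Ur.
  have E0 := GU 0%N r isT Ur; have E1 := GU 1%N r isT Ur.
  have E2 := GU 2%N r isT Ur.
  by rewrite /P2; eapply is_delta_eq; [by delta_solve|rewrite /=; ring].
move=> Ut; split; [exact: H1|exact: H2|exact: H3|].
rewrite (step 3 P3 (fun r =>
  (u3 r + 3 * u1 r ^+ 2 + 3 * u r * u2 r + 3 * u r ^+ 2 * u1 r) * G 0%N r
  + (4 * u2 r + 9 * u r * u1 r + u r ^+ 3) * G 1%N r
  + (6 * u1 r + 3 * u r ^+ 2) * G 2%N r + 3 * u r * G 3%N r + G 4%N r)) //.
  by rewrite /P3; ring.
move=> r Ur; have [D0 D1 D2] := uU r Ur.
have E0 := GU 0%N r isT Ur; have E1 := GU 1%N r isT Ur.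
have E2 := GU 2%N r isT Ur; have E3 := GU 3%N r isT Ur.
by rewrite /P3; eapply is_delta_eq; [by delta_solve|rewrite /=; ring].
Qed.
End GaugeTower.

(** [u] is the logarithmic [delta]-derivative of the factor with halved exponents. The numerators
    [1], [s + 1], [s^2 + 4 s + 1] are the Eulerian polynomials produced by iterating [delta] on
    [s / (s - 1)]. *)
Lemma is_delta_gauge_log (a c t : K) : t - 1 != 0 ->
  let u s := a / 2 + c / 2 * (s / (s - 1)) in
  let u1 s := - (c / 2 * (s / (s - 1) ^+ 2)) in
  let u2 s := c / 2 * (s * (s + 1) / (s - 1) ^+ 3) in
  let u3 s := - (c / 2 * (s * (s ^+ 2 + 4 * s + 1) / (s - 1) ^+ 4)) in
  [/\ is_delta u t (u1 t), is_delta u1 t (u2 t) & is_delta u2 t (u3 t)].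
Proof.
move=> t1 u u1 u2 u3.
have t1n n : (t - 1) ^+ n != 0 by rewrite expf_neq0.
have d1 : is_delta (fun s => s - 1) t (t - 0).
  by apply: is_deltaD; [exact: is_delta_id|rewrite oppr0; exact: is_delta_cst].
(* [delta_solve] has no rule for inverses, so the inverse powers of [s - 1] are supplied as
   atoms. *)
have dV n : is_delta (fun s => ((s - 1) ^+ n.+1)^-1) t
    (- (n.+1%:R * (t - 1) ^+ n * (t - 0)) / ((t - 1) ^+ n.+1) ^+ 2).
  by apply: is_deltaV => //; exact: is_deltaX.
have dV0 := dV 0%N; have dV1 := dV 1%N; have dV2 := dV 2%N.
split.
- by rewrite /u; eapply is_delta_eq; [by delta_solve|rewrite /= /u1; field].
- by rewrite /u1; eapply is_delta_eq; [by delta_solve|rewrite /= /u2; field].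
- by rewrite /u2; eapply is_delta_eq; [by delta_solve|rewrite /= /u3; field].
Qed.
End EulerDerivation.

(** * Algebraic identities behind the transformed equation *)

(** The whole computation at one point: values of functions and of their derivatives become
    independent variables tied by equations. After substitution both sides are [h^2] times the same
    quadratic form in [g0, ..., g4], with coefficients rational in [t]. *)
Lemma gauge_identity (K : fieldType) (t a c b1 b2 b3 b4 b5 b6 h : K)
  (g0 g1 g2 g3 g4 gH4 gH2 gdH2 gdS gddS : K)
  (f0 f1 f2 f3 f4 fH4 fH2 fdH2 fdS fddS h2 : K) :
  t - 1 != 0 -> (2 != 0 :> K) ->
  let u := a / 2 + c / 2 * (t / (t - 1)) in
  let u1 := - (c / 2 * (t / (t - 1) ^+ 2)) in
  let u2 := c / 2 * (t * (t + 1) / (t - 1) ^+ 3) in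
  let u3 := - (c / 2 * (t * (t ^+ 2 + 4 * t + 1) / (t - 1) ^+ 4)) in
  f0 = h * g0 ->
  f1 = h * (u * g0 + g1) ->
  f2 = h * ((u1 + u ^+ 2) * g0 + 2 * u * g1 + g2) ->
  f3 = h * ((u2 + 3 * u * u1 + u ^+ 3) * g0 + 3 * (u1 + u ^+ 2) * g1
    + 3 * u * g2 + g3) ->
  f4 = h * ((u3 + 4 * u * u2 + 3 * u1 ^+ 2 + 6 * u ^+ 2 * u1 + u ^+ 4) * g0
    + 4 * (u2 + 3 * u * u1 + u ^+ 3) * g1 + 6 * (u1 + u ^+ 2) * g2
    + 4 * u * g3 + g4) ->
  fH4 = 2 * f0 * f4 - 8 * f1 * f3 + 6 * f2 ^+ 2 ->
  fH2 = 2 * f0 * f2 - 2 * (f1 * f1) ->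
  fdH2 = 2 * f0 * f3 - 2 * f1 * f2 ->
  fdS = 2 * f0 * f1 ->
  fddS = 2 * f1 ^+ 2 + 2 * f0 * f2 ->
  gH4 = 2 * g0 * g4 - 8 * g1 * g3 + 6 * g2 ^+ 2 ->
  gH2 = 2 * g0 * g2 - 2 * (g1 * g1) ->
  gdH2 = 2 * g0 * g3 - 2 * g1 * g2 ->
  gdS = 2 * g0 * g1 ->
  gddS = 2 * g1 ^+ 2 + 2 * g0 * g2 ->
  h2 = h ^+ 2 ->
  (t - 1) ^+ 4 * fH4 + 2 * (t - 1) ^+ 3 * (t + 1) * fdH2
  + t * (t - 1) ^+ 2 * fddS
  + (t - 1) ^+ 2 * (t * (t - 1) + 1 - b1 - b5 * t - b6 * t ^+ 2) * fH2
  + t * (t - 1) * (b4 * (t - 1) - b1 - b5 - b6) * fdS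
  + t * (t - 1) * (b2 * t + b3) * f0 ^+ 2 =
  h2 *
  ((t - 1) ^+ 4 * gH4 + 2 * (t - 1) ^+ 3 * (t + 1) * gdH2
  + t * (t - 1) ^+ 2 * gddS
  + (t - 1) ^+ 2
      * (t * (t - 1) + 1 - b1 - 2 * a - (b5 + 4 * c) * t
         + (- b6 + 2 * a + 2 * c) * t ^+ 2) * gH2
  + t * (t - 1) * ((b4 + 2 * a) * (t - 1) - b1 - b5 - b6 - 2 * c) * gdS
  + t * (t - 1) * ((b2 + a ^+ 2 + a * b4 - c ^+ 2 + c * (b4 + b6)) * t
       + b3 - a * (a + b1 + b4 + b5 + b6) - c * b1 - 2 * a * c) * g0 ^+ 2).
Proof.
move=> t1 n2 u u1 u2 u3 -> -> -> -> -> -> -> -> -> -> -> -> -> -> -> ->.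
by rewrite /u /u1 /u2 /u3; field; rewrite n2 t1.
Qed.

(** In the coefficient of [d] the parameter shifts [2a], [4c] and [-2a - 2c] add up to [2c]; the
    other terms only regroup. *)
Lemma gauge_params_bracket (K : comNzRingType)
  (t a c b1 b2 b3 b4 b5 b6 h4 d2 dd h2 d g : K) :
  (t - 1) ^+ 4 * h4 + 2 * (t - 1) ^+ 3 * (t + 1) * d2 + t * (t - 1) ^+ 2 * dd
  + (t - 1) ^+ 2
      * (t * (t - 1) + 1 - b1 - 2 * a - (b5 + 4 * c) * t
         + (- b6 + 2 * a + 2 * c) * t ^+ 2) * h2
  + t * (t - 1) * ((b4 + 2 * a) * (t - 1) - b1 - b5 - b6 - 2 * c) * d
  + t * (t - 1) * ((b2 + a ^+ 2 + a * b4 - c ^+ 2 + c * (b4 + b6)) * t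
       + b3 - a * (a + b1 + b4 + b5 + b6) - c * b1 - 2 * a * c) * g =
  (t - 1) ^+ 4 * h4 + 2 * (t - 1) ^+ 3 * (t + 1) * d2 + t * (t - 1) ^+ 2 * dd
  + (t - 1) ^+ 2
      * (t * (t - 1) + 1 - (b1 + 2 * a) - (b5 + 4 * c) * t
         - (b6 - 2 * a - 2 * c) * t ^+ 2) * h2
  + t * (t - 1) * ((b4 + 2 * a) * (t - 1) - (b1 + 2 * a) - (b5 + 4 * c)
       - (b6 - 2 * a - 2 * c)) * d
  + t * (t - 1) * ((b2 + a ^+ 2 + a * b4 - c ^+ 2 + c * (b4 + b6)) * t
       + (b3 - a * (a + b1 + b4 + b5 + b6) - c * b1 - 2 * a * c)) * g.
Proof. ring. Qed.

(** The shifts [4a], [4c] and [-4a - 4c] cancel. *)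
Lemma gauge_invariant (K : comNzRingType) (b4 b5 b6 a c : K) :
  2 * (b4 + 2 * a) + (b5 + 4 * c) + 2 * (b6 - 2 * a - 2 * c) = 2 * b4 + b5 + 2 * b6.
Proof. ring. Qed.

(** * Logarithmic derivatives of products of powers *)

Lemma is_derive_exp_scale (K : numFieldType) (e l : K -> K) (k d t : K) :
  is_derive (k * l t) 1 e (e (k * l t)) -> is_derive t 1 l d ->
  is_derive t 1 (fun s => e (k * l s)) (e (k * l t) * (k * d)).
Proof.
by move=> eD lD; apply: (is_derive_comp_num e (fun s => k * l s)).
Qed.

Lemma is_delta_of_is_derive (K : numFieldType) (f : K -> K) (t d : K) :
  is_derive t 1 f d -> is_delta f t (t * d).
Proof. by move=> [df <-]; split; [exact: df|rewrite derive1E]. Qed.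

(** Logarithmic derivatives add; the result has the shape required by [derivs_linear_ode]. *)
Lemma is_derive_prod_exp (K : numFieldType) (p q : K -> K) (t v w : K) :
  is_derive t 1 p (p t * v) -> is_derive t 1 q (q t * w) ->
  is_derive t 1 (fun s => p s * q s) ((v + w) * (p t * q t)).
Proof.
move=> [dp pE] [dq qE]; apply: DeriveDef; first exact: derivableM.
rewrite deriveM // pE qE -[p t *: _]/(p t * _) -[q t *: _]/(q t * _); ring.
Qed.

Lemma gauge_exponent (K : fieldType) (t a c : K) : t != 0 -> t - 1 != 0 ->
  t * (a * t^-1 + c * (t - 1)^-1) = a + c * (t / (t - 1)).
Proof. by move=> t0 t1; field; rewrite t0 t1. Qed.

Lemma derivs_gauge_exponent (K : numFieldType) (U : set K) (oU : open U)
    (a c : K) n :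
  (forall t, U t -> t != 0) -> (forall t, U t -> t - 1 != 0) ->
  derivs n U (fun t => a * t^-1 + c * (t - 1)^-1).
Proof.
move=> U0 U1; have dl k : derivs n U (fun t => t + k).
  by apply: (derivsD U oU n id (fun=> k)); [exact: derivs_id|exact: derivs_cst].
apply: (derivsD U oU n (fun t => a * t^-1)).
  apply: (derivsM U oU n (fun=> a)); first exact: derivs_cst.
  by apply: (derivsV U oU n id U0); exact: derivs_id.
apply: (derivsM U oU n (fun=> c)); first exact: derivs_cst.
by apply: (derivsV U oU n (fun t => t - 1) U1).
Qed.

(** * The gauge transformation over the complex numbers *)

Section Gauge.
Context {R : realType}.
Local Notation C := (Cplx R).
Implicit Types (f g : C -> C) (U : set C) (t a c : C).

Lemma is_derive_cexp (z : C) : is_derive z 1 (cexp : C -> C) (cexp z).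
Proof.
have [E [EE E0 Ec]] := @cexp_slope R.
exact: (is_derive_exponential cexp E cexpD EE E0 Ec).
Qed.

Lemma is_derive_log_branch U l (k t : C) :
  open U -> log_branch U (fun s => s - k) l -> U t ->
  is_derive t 1 l (t - k)^-1.
Proof.
move=> oU lU Ut; have [E [EE E0 Ec]] := @cexp_slope R.
apply: (is_derive_logarithm cexp E cexpD EE E0 Ec U) => //.
by have [_ <-] := lU t Ut; exact: cexp_neq0.
Qed.

Lemma gauge_factorD (l0 l1 : C -> C) a c a' c' t :
  gauge_factor l0 l1 (a + a') (c + c') t =
  gauge_factor l0 l1 a c t * gauge_factor l0 l1 a' c' t.
Proof. by rewrite /gauge_factor !mulrDl !cexpD mulrACA. Qed.

Lemma gauge_factor_neq0 (l0 l1 : C -> C) a c t : gauge_factor l0 l1 a c t != 0.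
Proof. by rewrite mulf_neq0 ?cexp_neq0. Qed.

Lemma gauge_factor0 (l0 l1 : C -> C) t : gauge_factor l0 l1 0 0 t = 1.
Proof. by rewrite /gauge_factor !mul0r cexp0 mulr1. Qed.

(** Identifies the [h^2] of the quadratic expression, where [h] has halved exponents, with the full
    factor. *)
Lemma gauge_factor_half (l0 l1 : C -> C) a c t :
  gauge_factor l0 l1 a c t = gauge_factor l0 l1 (a / 2) (c / 2) t ^+ 2.
Proof.
have half (x : C) : x = x / 2 + x / 2 by rewrite -splitr.
by rewrite {1}(half a) {1}(half c) gauge_factorD expr2.
Qed.

(** The factor with opposite exponents is the inverse; this gives the converse direction in
    [gauge_solution]. *)
Lemma gauge_related_sym U (l0 l1 : C -> C) a c f g :
  gauge_related U l0 l1 a c f g -> gauge_related U l0 l1 (- a) (- c) g f.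
Proof.
move=> fg t Ut; rewrite fg // mulrA -gauge_factorD !mulNr !addNr.
by rewrite gauge_factor0 mul1r.
Qed.

Lemma gauge_related_exists U (l0 l1 : C -> C) a c f :
  exists g, gauge_related U l0 l1 a c f g.
Proof.
exists (fun t => (gauge_factor l0 l1 (a / 2) (c / 2) t)^-1 * f t) => t _.
by rewrite mulrA mulfV ?mul1r // gauge_factor_neq0.
Qed.

Section BranchedDomain.
Context (U : set C) (l0 l1 : C -> C) (bU : branched_domain U l0 l1).

Let oU : open U. Proof. by case: bU. Qed.

Lemma branched_domain_neq0 t : U t -> t != 0.
Proof. by move=> Ut; case: bU => _ /(_ t Ut)[_ <-] _; exact: cexp_neq0. Qed.

Lemma branched_domain_neq1 t : U t -> t - 1 != 0.
Proof. by move=> Ut; case: bU => _ _ /(_ t Ut)[_ <-]; exact: cexp_neq0. Qed.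

Lemma is_derive_gauge_factor a c t : U t ->
  is_derive t 1 (gauge_factor l0 l1 a c)
    ((a * t^-1 + c * (t - 1)^-1) * gauge_factor l0 l1 a c t).
Proof.
move=> Ut; case: bU => _ b0 b1.
have b0' : log_branch U (fun s => s - 0) l0.
  by move=> s Us; have [? ?] := b0 s Us; split => //; rewrite subr0.
have d0 := is_derive_log_branch U l0 0 t oU b0' Ut.
have d1 := is_derive_log_branch U l1 1 t oU b1 Ut.
rewrite subr0 in d0.
exact: (is_derive_prod_exp C _ _ t _ _
  (is_derive_exp_scale C cexp l0 a _ t (is_derive_cexp _) d0)
  (is_derive_exp_scale C cexp l1 c _ t (is_derive_cexp _) d1)).
Qed.

(** The factor solves [h' = v h] with [v] rational and regular on [U], so its regularity follows by
    bootstrapping. *)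
Lemma derivs_gauge_factor a c n : derivs n U (gauge_factor l0 l1 a c).
Proof.
apply: (derivs_linear_ode U oU n _ (fun t => a * t^-1 + c * (t - 1)^-1)).
  exact: (derivs_gauge_exponent C U oU _ _ _ branched_domain_neq0 branched_domain_neq1).
exact: is_derive_gauge_factor.
Qed.

Lemma gauge_related_derivs a c f g n : gauge_related U l0 l1 a c f g ->
  derivs n U g -> derivs n U f.
Proof.
move=> fg dg; apply: (eq_derivs U oU n
  (fun t => gauge_factor l0 l1 (a / 2) (c / 2) t * g t)) => [t Ut|].
  by rewrite fg.
exact: (derivsM U oU n (gauge_factor l0 l1 (a / 2) (c / 2)) g
  (derivs_gauge_factor _ _ _) dg).
Qed.

Lemma is_delta_gauge_factor a c t : U t ->
  is_delta (gauge_factor l0 l1 a c) t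
    (gauge_factor l0 l1 a c t * (a + c * (t / (t - 1)))).
Proof.
move=> Ut; have := is_delta_of_is_derive C _ _ _ (is_derive_gauge_factor a c t Ut).
by rewrite mulrA (gauge_exponent C t a c (branched_domain_neq0 t Ut)
  (branched_domain_neq1 t Ut)) mulrC.
Qed.
End BranchedDomain.

Lemma derivs_delta n U f : open U -> derivs n.+1 U f -> derivs n U (delta f).
Proof.
move=> oU /derivsS[_ df]; exact: (derivsM U oU n id (derive1 f) (derivs_id U oU n) df).
Qed.

Lemma derivs_iter_delta n k U f : open U ->
  derivs (k + n) U f -> derivs n U (iter k delta f).
Proof.
by move=> oU; elim: k n => // k IH n; rewrite addSnnS => /IH/(derivs_delta _ _ _ oU).
Qed.

(** Each [delta] costs one derivative, so [delta^k f] with [k < 4] can still be differentiated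
    once. *)
Lemma iter_delta_tower U f : open U -> derivs 4 U f ->
  delta_tower U (fun k => iter k delta f).
Proof.
move=> oU df k t k4 Ut; split; last by [].
apply: (derivs_derivable 0 U _ _ _ Ut); apply: derivs_iter_delta => //.
by apply: derivsW df; rewrite addn1.
Qed.

Lemma hirota2E f t : hirota 2 f f t =
  2 * f t * iter 2 delta f t - 2 * (delta f t * delta f t).
Proof. exact: (hirota2_sum C (fun k => iter k delta f t)). Qed.

Lemma hirota4E f t : hirota 4 f f t =
  2 * f t * iter 4 delta f t - 8 * delta f t * iter 3 delta f t
  + 6 * iter 2 delta f t ^+ 2.
Proof. exact: (hirota4_sum C (fun k => iter k delta f t)). Qed.

Lemma delta_hirota2E U f t : open U -> derivs 4 U f -> U t ->
  delta (hirota 2 f f) t =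
  2 * f t * iter 3 delta f t - 2 * delta f t * iter 2 delta f t.
Proof.
(* The expansion is purely algebraic, hence an equality of functions on all of [C], usable under
   [delta]. *)
move=> oU df Ut; rewrite (funext (hirota2E f)).
by have [_] := is_delta_hirota2 U _ (iter_delta_tower _ _ oU df) t Ut.
Qed.

Lemma delta_sqrE U f t : open U -> derivs 4 U f -> U t ->
  delta (fun s => f s ^+ 2) t = 2 * f t * delta f t.
Proof.
move=> oU df Ut.
by have [_] := is_delta_sqr U _ (iter_delta_tower _ _ oU df) t Ut.
Qed.

Lemma delta2_sqrE U f t : open U -> derivs 4 U f -> U t ->
  delta (delta (fun s => f s ^+ 2)) t =
  2 * delta f t ^+ 2 + 2 * f t * iter 2 delta f t.
Proof.
move=> oU df Ut.
have dE s : U s -> delta (fun s => f s ^+ 2) s = 2 * f s * delta f s.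
  exact: delta_sqrE.
by have [_] := is_delta2_sqr U oU _ (iter_delta_tower _ _ oU df) t Ut _ dE.
Qed.

Lemma Lop_gauge (b : params R) a c U (l0 l1 f g : C -> C) :
  branched_domain U l0 l1 -> derivs 4 U g -> gauge_related U l0 l1 a c f g ->
  forall t, U t ->
    Lop b f t = gauge_factor l0 l1 a c t *
       ((t - 1) ^+ 4 * hirota 4 g g t
        + 2 * (t - 1) ^+ 3 * (t + 1) * delta (hirota 2 g g) t
        + t * (t - 1) ^+ 2 * delta (delta (fun s => g s ^+ 2)) t
        + (t - 1) ^+ 2
            * (t * (t - 1) + 1 - beta1 b - 2 * a - (beta5 b + 4 * c) * t
               + (- beta6 b + 2 * a + 2 * c) * t ^+ 2)
            * hirota 2 g g t
        + t * (t - 1)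
            * ((beta4 b + 2 * a) * (t - 1)
               - beta1 b - beta5 b - beta6 b - 2 * c)
            * delta (fun s => g s ^+ 2) t
        + t * (t - 1)
            * ((beta2 b + a ^+ 2 + a * beta4 b - c ^+ 2
                + c * (beta4 b + beta6 b)) * t
               + beta3 b - a * (a + beta1 b + beta4 b + beta5 b + beta6 b)
               - c * beta1 b - 2 * a * c)
            * g t ^+ 2).
Proof.
move=> bU dg fg t Ut; have oU : open U by case: bU.
have two0 : (2 : C) != 0 by rewrite pnatr_eq0.
have df := gauge_related_derivs _ _ _ bU _ _ _ _ _ fg dg.
have ug s (Us : U s) := is_delta_gauge_log a c s (branched_domain_neq1 _ _ _ bU s Us).
have [f1 f2 f3 f4] := gauge_tower U oU _ _ (iter_delta_tower _ _ oU df)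
  (iter_delta_tower _ _ oU dg) _ _ _ _ _
  (is_delta_gauge_factor _ _ _ bU (a / 2) (c / 2))
  ug fg t Ut.
exact: (gauge_identity C t a c _ _ _ _ _ _ _ _ _ _ _ _ _ _ _ _ _ _ _ _ _ _ _ _ _ _ _ _
  (branched_domain_neq1 _ _ _ bU t Ut) two0 (fg t Ut) f1 f2 f3 f4
  (hirota4E f t) (hirota2E f t) (delta_hirota2E U f t oU df Ut)
  (delta_sqrE U f t oU df Ut) (delta2_sqrE U f t oU df Ut)
  (hirota4E g t) (hirota2E g t) (delta_hirota2E U g t oU dg Ut)
  (delta_sqrE U g t oU dg Ut) (delta2_sqrE U g t oU dg Ut)
  (gauge_factor_half l0 l1 a c t)).
Qed.

Lemma Lop_gauge_params (b : params R) a c U (l0 l1 f g : C -> C) :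
  branched_domain U l0 l1 -> derivs 4 U g -> gauge_related U l0 l1 a c f g ->
  forall t, U t ->
    Lop b f t = gauge_factor l0 l1 a c t * Lop (gauge_params a c b) g t.
Proof.
move=> bU dg fg t Ut; rewrite (Lop_gauge b a c U l0 l1 f g) //; congr (_ * _).
exact: gauge_params_bracket.
Qed.

(** The factor never vanishes, so both expressions vanish together; differentiability transfers
    either way through the factor or its inverse. *)
Lemma gauge_solution (b : params R) a c U (l0 l1 f g : C -> C) :
  branched_domain U l0 l1 -> gauge_related U l0 l1 a c f g ->
  solution b U f <-> solution (gauge_params a c b) U g.
Proof.
move=> bU fg; split=> -[d sol].
  have dg : derivs 4 U g.
    exact: (gauge_related_derivs _ _ _ bU _ _ _ _ _ (gauge_related_sym _ _ _ _ _ _ _ fg) d).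
  split=> // t Ut; apply/eqP.
  have /eqP := Lop_gauge_params b a c U l0 l1 f g bU dg fg t Ut.
  by rewrite sol // eq_sym mulf_eq0 (negPf (gauge_factor_neq0 _ _ _ _ _)).
split=> [|t Ut]; first exact: (gauge_related_derivs _ _ _ bU _ _ _ _ _ fg d).
by rewrite (Lop_gauge_params b a c U l0 l1 f g) // sol // mulr0.
Qed.
End Gauge.

Theorem mainTheorem2 (R : realType) :
  (forall (b : params R) (a c : Cplx R) (U : set (Cplx R))
      (l0 l1 f g : Cplx R -> Cplx R),
    branched_domain U l0 l1 ->
    differentiable4 U g ->
    gauge_related U l0 l1 a c f g ->
    forall t : Cplx R, U t ->
      Lop b f t = gauge_factor l0 l1 a c t *
       ((t - 1) ^+ 4 * hirota 4 g g t
        + 2 * (t - 1) ^+ 3 * (t + 1) * delta (hirota 2 g g) t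
        + t * (t - 1) ^+ 2 * delta (delta (fun s => g s ^+ 2)) t
        + (t - 1) ^+ 2
            * (t * (t - 1) + 1 - beta1 b - 2 * a - (beta5 b + 4 * c) * t
               + (- beta6 b + 2 * a + 2 * c) * t ^+ 2)
            * hirota 2 g g t
        + t * (t - 1)
            * ((beta4 b + 2 * a) * (t - 1)
               - beta1 b - beta5 b - beta6 b - 2 * c)
            * delta (fun s => g s ^+ 2) t
        + t * (t - 1)
            * ((beta2 b + a ^+ 2 + a * beta4 b - c ^+ 2
                + c * (beta4 b + beta6 b)) * t
               + beta3 b - a * (a + beta1 b + beta4 b + beta5 b + beta6 b)
               - c * beta1 b - 2 * a * c)
            * g t ^+ 2)
      /\ Lop b f t = gauge_factor l0 l1 a c t * Lop (gauge_params a c b) g t)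
  /\
  (forall b : params R, exists a c : Cplx R,
    [/\ beta5 (gauge_params a c b) = 0,
        beta6 (gauge_params a c b) = 0
      & forall (U : set (Cplx R)) (l0 l1 : Cplx R -> Cplx R),
          branched_domain U l0 l1 ->
          (forall f : Cplx R -> Cplx R, exists g : Cplx R -> Cplx R,
             gauge_related U l0 l1 a c f g)
          /\ (forall f g : Cplx R -> Cplx R, gauge_related U l0 l1 a c f g ->
               (solution b U f <-> solution (gauge_params a c b) U g))])
  /\
  (forall (b : params R) (a c : Cplx R),
    2 * beta4 (gauge_params a c b) + beta5 (gauge_params a c b)
      + 2 * beta6 (gauge_params a c b)
    = 2 * beta4 b + beta5 b + 2 * beta6 b).
Proof.
split=> [b a c U l0 l1 f g bU dg fg t Ut|].
  by split; [exact: (Lop_gauge b a c U)|exact: (Lop_gauge_params b a c U)].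
split=> [b|b a c].
  have four0 : (4 : Cplx R) != 0 by rewrite pnatr_eq0.
  have two0 : (2 : Cplx R) != 0 by rewrite pnatr_eq0.
  (* [beta5 + 4 c = 0] determines [c]; then [beta6 - 2 a - 2 c = 0] determines [a]. *)
  exists (beta6 b / 2 + beta5 b / 4), (- (beta5 b / 4)); split.
  - by rewrite /= mulrN mulrC divfK // subrr.
  - by rewrite /= mulrDr mulrN opprD opprK addrA subrK mulrC divfK // subrr.
  - move=> U l0 l1 bU; split=> [f|f g fg]; last exact: gauge_solution bU fg.
    exact: gauge_related_exists.
exact: gauge_invariant.
Qed.
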